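(* Let $d=(d_1,\ldots,d_n)$ be a tree degree sequence with $n\geq 3$ (so $d_1\geq\cdots\geq d_n$), and let $\nu$ be an integer. There is a tree $T$ with degree sequence $d$ and $\nu(T)=\nu$ if and only if $$\min\Big\{ k\in \mathbb{N}:\sum_{i=1}^k d_i\geq n-1\Big\}\;\leq\; \nu\;\leq\; \min\left\{ \left\lfloor \frac{n}{2}\right\rfloor,\; n-n_1(d)\right\}.$$
   Context: All graphs are finite, simple and undirected. The degree sequence of a graph is the nonincreasing sequence of its vertex degrees. A tree degree sequence is the degree sequence of some tree. $n_1(d)$ is the number of elements of $d$ equal to $1$. $\nu(T)$ denotes the matching number of $T$. *)

(* Defs.v *)
From mathcomp Require Import all_boot.
Set Implicit Arguments. Unset Strict Implicit. Unset Printing Implicit Defensive.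

Definition simple_graph n (e : rel 'I_n) : Prop :=
  (forall x y, e x y = e y x) /\ irreflexive e.

Definition connected_graph n (e : rel 'I_n) : Prop :=
  forall x y, connect e x y.

Definition acyclic_graph n (e : rel 'I_n) : Prop :=
  forall c : seq 'I_n, uniq c -> 3 <= size c -> ~~ cycle e c.

Definition is_tree n (e : rel 'I_n) : Prop :=
  simple_graph e /\ connected_graph e /\ acyclic_graph e.

Definition deg n (e : rel 'I_n) (v : 'I_n) : nat := #|[set w | e v w]|.

Definition degree_seq n (e : rel 'I_n) : seq nat :=
  sort geq [seq deg e v | v <- enum 'I_n].

Definition is_tree_degree_sequence (n : nat) (d : seq nat) : Prop :=
  exists e : rel 'I_n, is_tree e /\ degree_seq e = d.

Definition is_matching n (e : rel 'I_n) (M : {set {set 'I_n}}) : bool :=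
  [forall A in M, exists x, exists y, e x y && (A == [set x; y])] && trivIset M.

Definition matching_number n (e : rel 'I_n) : nat :=
  \max_(M : {set {set 'I_n}} | is_matching e M) #|M|.

(* min { k in N : d_1 + ... + d_k >= m }; for k > size d the partial sums are
   constant, so searching k in [0, size d] suffices (junk value size d + 1
   if no such k exists, which never happens for tree degree sequences). *)
Definition min_prefix (d : seq nat) (m : nat) : nat :=
  find (fun k => m <= \sum_(i < k) nth 0 d i) (iota 0 (size d).+1).

Definition n1 (d : seq nat) : nat := count_mem 1 d.

(* Main.v *)
(* Necessity: a tree arises from one vertex by repeatedly attaching a pendant
   vertex.  König's equality, obtained by matching pendant edges greedily, gives
   a vertex cover of size nu, whose degrees sum to at least the number n - 1 of
   edges.  The non-leaves also form a vertex cover.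

   Sufficiency: let C consist of nu vertices of largest degree and B of the
   others.  There is a tree with the same degrees in which B is independent and
   C is matched into B; then C is a cover and the matching has size nu.  *)

Require Import Defs.
From mathcomp Require Import all_boot zify.

Set Implicit Arguments.
Unset Strict Implicit.
Unset Printing Implicit Defensive.

(* Elaboration leaves [reverse_coercion] in some of the cardinals and sums over
   ['I_n], which [lia] would see as distinct atoms. *)
Ltac card_lia := unfold reverse_coercion in *; lia.

(** * Trees as edge lists grown by pendant vertices *)

Section EdgeLists.

Variable n : nat.
Implicit Types (x y z v w c b : 'I_n) (E : seq ('I_n * 'I_n)) (V A C B K : {set 'I_n}).
Implicit Types (M : {set {set 'I_n}}) (f : 'I_n -> nat) (e : rel 'I_n).

Definition adj E : rel 'I_n := fun x y => ((x, y) \in E) || ((y, x) \in E).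

(** Occurrences are counted with multiplicity, so the count is additive in the list; [deg_grown]
    identifies it with [deg] on grown lists. *)
Definition edge_deg E v := count_mem v (unzip1 E) + count_mem v (unzip2 E).

(** The newest vertex is the second component of the head edge and has no other neighbour, so
    induction on [grown] is induction by removing a leaf. *)
Inductive grown : {set 'I_n} -> seq ('I_n * 'I_n) -> Prop :=
| grown1 x : grown [set x] [::]
| grownS V E x y : grown V E -> x \in V -> y \notin V ->
    grown (y |: V) ((x, y) :: E).

Lemma adj_sym E : symmetric (adj E).
Proof. by move=> x y; rewrite /adj orbC. Qed.

Lemma adj_cons x y E v w :
  adj ((x, y) :: E) v w = [|| (v == x) && (w == y), (v == y) && (w == x) | adj E v w].
Proof. by rewrite /adj !inE !xpair_eqE (andbC (w == x)) orbACA -orbA. Qed.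

Lemma edge_deg_cons x y E v :
  edge_deg ((x, y) :: E) v = (x == v) + (y == v) + edge_deg E v.
Proof. exact: addnACA. Qed.

Lemma adj_grownl V E x y : grown V E -> adj E x y -> x \in V.
Proof.
move=> gE; elim: gE x y => // {}V {}E a b _ IH aV bV x y.
rewrite adj_cons !inE; case/or3P => [/andP[/eqP-> _]|/andP[-> _]//|/IH->].
  by rewrite aV orbT.
by rewrite orbT.
Qed.

Lemma adj_grownr V E x y : grown V E -> adj E x y -> y \in V.
Proof. by rewrite adj_sym; apply: adj_grownl. Qed.

Lemma edge_deg_notin V E v : grown V E -> v \notin V -> edge_deg E v = 0.
Proof.
move=> gE; elim: gE => // {}V {}E a b _ IH aV bV.
rewrite !inE negb_or => /andP[vb vV].
rewrite edge_deg_cons (IH vV).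
have -> : (a == v) = false by apply: contraNF vV => /eqP <-.
by rewrite eq_sym (negbTE vb).
Qed.

(** The new vertex has no earlier neighbour, so a grown list never repeats an edge and list entries
    correspond to neighbours. *)
Lemma deg_grown V E v : grown V E -> deg (adj E) v = edge_deg E v.
Proof.
move=> gE; elim: gE => [x|{}V {}E x y gE IH xV yV].
  by apply/eqP; rewrite cards_eq0 -subset0; apply/subsetP => w; rewrite inE.
have xy : x != y by apply: contraNneq yV => <-.
have nE w : adj E y w = false by apply: contraNF yV; apply: adj_grownl gE.
rewrite edge_deg_cons -IH /deg.
have [vx|vx] := eqVneq x v.
  subst v; rewrite eq_sym (negbTE xy).
  have -> : [set w | adj ((x, y) :: E) x w] = y |: [set w | adj E x w].
    by apply/setP => w; rewrite !inE adj_cons eqxx (negbTE xy).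
  by rewrite cardsU1 inE adj_sym nE.
have [vy|vy] := eqVneq y v.
  subst v; have -> : [set w | adj ((x, y) :: E) y w] = [set x].
    by apply/setP => w; rewrite !inE adj_cons eqxx eq_sym (negbTE xy) nE orbF.
  by rewrite cards1 -/(deg _ _) IH (edge_deg_notin gE).
rewrite !add0n; congr #|pred_of_set _|; apply/setP => w.
by rewrite !inE adj_cons !(eq_sym v) (negbTE vx) (negbTE vy).
Qed.

Lemma grown_connect V E x y : grown V E -> x \in V -> y \in V -> connect (adj E) x y.
Proof.
move=> gE; elim: gE x y => [a x y|{}V {}E a b gE IH aV bV x y].
  by rewrite !inE => /eqP-> /eqP->.
have sub u w : connect (adj E) u w -> connect (adj ((a, b) :: E)) u w.
  by apply: connect_sub => {}u {}w uw; apply: connect1; rewrite adj_cons uw !orbT.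
have ab : connect (adj ((a, b) :: E)) a b by apply: connect1; rewrite adj_cons !eqxx.
have ba : connect (adj ((a, b) :: E)) b a.
  by apply: connect1; rewrite adj_cons !eqxx orbT.
rewrite !inE => /orP[/eqP->|xV] /orP[/eqP->|yV] //.
- by apply: connect_trans ba _; apply/sub/IH.
- by apply: connect_trans ab; apply/sub/IH.
- by apply/sub/IH.
Qed.

(** A cycle through the newest vertex [y] would have both cycle-neighbours of [y] equal to [x], its
    only neighbour; a cycle avoiding [y] is an earlier one. *)
Lemma grown_acyclic V E : grown V E -> acyclic_graph (adj E).
Proof.
move=> gE; elim: gE => [x|{}V {}E x y gE IH xV yV] c uc sc.
  by case: c sc uc => [|a [|b c]].
have ny w : adj E y w = false by apply: contraNF yV; apply: adj_grownl gE.
have xy : x != y by apply: contraNneq yV => <-.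
have [yc|yc] := boolP (y \in c); last first.
  apply: contra (IH c uc sc).
  apply: (@sub_in_cycle _ (predC1 y)); last first.
    by apply/allP => w wc; apply: contraNneq yc => <-.
  by move=> v w /negbTE /= vy /negbTE /= wy; rewrite adj_cons vy wy andbF.
have [i c' rc] := rot_to yc.
rewrite -(rot_cycle i) rc; have := uc; rewrite -(rot_uniq i) rc.
have := sc; rewrite -(size_rot i) rc; case: c' {rc} => [|a [|b l]] //= _.
case/and3P => _ al _; apply/negP; rewrite rcons_path => /and4P[ya _ _ ly].
have ax : a = x.
  by move: ya; rewrite adj_cons eqxx eq_sym (negbTE xy) ny orbF => /eqP.
have lx : last b l = x.
  move: ly; rewrite adj_sym adj_cons eqxx eq_sym (negbTE xy) ny orbF.
  by move=> /eqP.
by move: al; rewrite ax -lx mem_last.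
Qed.

Lemma grown_irrefl V E : grown V E -> irreflexive (adj E).
Proof.
elim=> // {}V {}E x y _ IH xV yV v.
have xy : x != y by apply: contraNneq yV => <-.
rewrite adj_cons IH orbF; have [->|//] := eqVneq v x.
  by rewrite (negbTE xy).
by rewrite andbF.
Qed.

Lemma grown_is_tree E : grown setT E -> is_tree (adj E).
Proof.
move=> gE; split; [split|split].
- exact: adj_sym.
- exact: grown_irrefl gE.
- by move=> x y; apply: (grown_connect gE); rewrite inE.
- exact: grown_acyclic gE.
Qed.

(** * Every tree is grown *)

Lemma connected_crossing e V x y : connected_graph e -> x \in V -> y \notin V ->
  exists a b, [/\ a \in V, b \notin V & e a b].
Proof.
move=> ce; have /connectP[p] := ce x y.
elim: p x => [x _ -> -> //|a p IH x /= /andP[xa pa] ly xV yV].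
have [aV|aV] := boolP (a \in V); first exact: (IH a).
by exists x, a.
Qed.

(** Connectedness supplies an edge leaving the current vertex set, and acyclicity makes it the only
    edge from that set to the new vertex. Hence the list stays equal to the subgraph induced by
    [e]. *)
Lemma tree_grown e : 0 < n -> is_tree e ->
  exists2 E, grown setT E & forall x y, e x y = adj E x y.
Proof.
move=> n0 [[se ie] [ce ae]].
have: exists V E, [/\ grown V E, #|V| = n & {in V &, forall x y, e x y = adj E x y}].
  have H k : 0 < k <= n -> exists V E,
      [/\ grown V E, #|V| = k & {in V &, forall x y, e x y = adj E x y}].
    elim: k => // k IH kn.
    have [k0|k0] := posnP k.
      exists [set Ordinal n0], [::]; split; first exact: grown1.
        by rewrite cards1 k0.
      by move=> x y; rewrite !inE => /eqP-> /eqP->; rewrite ie.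
    have [|V [E [gE cV eV]]] := IH; first by rewrite k0 ltnW; move: kn => /andP[].
    have /card_gt0P[x0 x0V] : 0 < #|V| by rewrite cV.
    have /card_gt0P[y0 y0V] : 0 < #|~: V|.
      by have := cardsC V; rewrite card_ord cV; lia.
    rewrite inE in y0V.
    have [x [y [xV yV xy]]] := connected_crossing ce x0V y0V.
    (* A second neighbour [z] of [y] in [V] closes a cycle: from [y] to [x], along a simple path
       inside [V] to [z], and back to [y]. *)
    have uy z : z \in V -> e z y -> z = x.
      move=> zV zy; apply/eqP; apply: contraT => zx.
      have /connectP[p pp lp] := grown_connect gE xV zV.
      case/shortenP: pp lp => q pq uq _ lq.
      have sV w : w \in x :: q -> w \in V.
        rewrite inE => /orP[/eqP->//|wq].
        elim: q x {uq lq xy xV zx} pq wq => //= a q IHq x /andP[xa aq].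
        by rewrite inE => /orP[/eqP->|]; [apply: adj_grownr gE xa | exact: (IHq a)].
      have /negP[] : ~~ cycle e (y :: x :: q).
        apply: ae => /=.
          rewrite -/(uniq (x :: q)) uq andbT; apply: contra yV; exact: sV.
        by case: q lq {pq uq sV} zx => //= ->; rewrite eqxx.
      rewrite /= se xy rcons_path -lq zy andbT /=.
      apply: (@sub_in_path _ (mem V) _ _ _ _ _ _ pq); last exact/allP.
      by move=> u w uV wV; rewrite /= eV.
    have nE w : adj E y w = false by apply: contraNF yV; apply: adj_grownl gE.
    exists (y |: V), ((x, y) :: E); split; first exact: grownS.
      by rewrite cardsU1 yV cV.
    have ey z : z \in V -> e z y = (z == x).
      by move=> zV; apply/idP/eqP => [/uy->//|->].
    have ne z : z \in V -> (z == y) = false.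
      by move=> zV; apply: contraNF yV => /eqP <-.
    have yx : (y == x) = false by rewrite eq_sym ne.
    move=> u w; rewrite !inE !adj_cons => /orP[/eqP->|uV] /orP[/eqP->|wV].
    - by rewrite ie eqxx yx nE.
    - by rewrite se ey // eqxx nE yx orbF.
    - by rewrite ey // eqxx adj_sym nE ne // andbT /= orbF.
    - by rewrite eV // !ne // andbF.
  by apply: H; rewrite n0 leqnn.
move=> [V [E [gE cV eV]]].
have VT : V = setT by apply/eqP; rewrite eqEcard subsetT cardsT card_ord cV leqnn.
by subst V; exists E => // x y; apply: eV; rewrite inE.
Qed.

(** * Matchings, vertex covers and König's equality *)

Lemma matching_sub e e' M : subrel e e' -> is_matching e M -> is_matching e' M.
Proof.
move=> ee' /andP[/forall_inP eM tM]; rewrite /is_matching tM andbT.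
apply/forall_inP => A /eM /existsP[x /existsP[y /andP[xy AE]]].
by apply/existsP; exists x; apply/existsP; exists y; rewrite ee'.
Qed.

Lemma matchingP e M A : is_matching e M -> A \in M ->
  exists x y, e x y /\ A = [set x; y].
Proof.
move=> /andP[/forall_inP eM _] /eM /existsP[x /existsP[y /andP[xy /eqP]]].
by exists x, y.
Qed.

Lemma matchingU1 e M x y : is_matching e M -> e x y ->
  x \notin cover M -> y \notin cover M ->
  is_matching e ([set x; y] |: M) /\ #|[set x; y] |: M| = #|M|.+1.
Proof.
move=> mM xy xM yM.
have dis : {in M, forall A, [disjoint [set x; y] & A]}.
  move=> A AM; rewrite disjoint_subset; apply/subsetP => z; rewrite !inE.
  by case/orP => /eqP->; [apply: contra xM|apply: contra yM] => zA;
    apply/bigcupP; exists A.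
have M0 : set0 \notin M.
  apply/negP => /(matchingP mM)[a [b [_ /setP/(_ a)]]].
  by rewrite !inE eqxx.
have /andP[/forall_inP eM tM] := mM.
have [tU AM] := trivIsetU1 dis tM M0.
rewrite cardsU1 AM /is_matching tU andbT; split => //.
apply/forall_inP => A; rewrite !inE => /orP[/eqP->|/eM//].
by apply/existsP; exists x; apply/existsP; exists y; rewrite xy eqxx.
Qed.

(** Sending each matching edge to a vertex of [K] on it is injective, because matching edges are
    disjoint. *)
Lemma matching_le_cover e M K : is_matching e M ->
  (forall x y, e x y -> (x \in K) || (y \in K)) -> #|M| <= #|K|.
Proof.
move=> mM eK; pose g (A : {set 'I_n}) := [pick x in A :&: K].
have gP A : A \in M -> exists2 x, g A = Some x & x \in A :&: K.
  move=> /(matchingP mM)[x [y [/eK xyK AE]]]; rewrite /g; case: pickP => [z zA|no].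
    by exists z.
  have := no x; have := no y; rewrite AE !inE !eqxx !orbT /= => yK xK.
  by rewrite xK yK in xyK.
have g_inj : {in M &, injective g}.
  move=> A A' AM A'M; have [x -> xA] := gP A AM; have [y -> yA'] := gP A' A'M.
  case=> xy; subst y; apply/eqP; apply: contraT => AA'.
  have /andP[_ /trivIsetP/(_ A A' AM A'M AA')] := mM.
  rewrite disjoint_subset => /subsetP/(_ x).
  by move: xA yA'; rewrite !inE => /andP[-> _] /andP[-> _] /(_ isT).
rewrite -(card_in_imset g_inj) -(card_imset (mem K) (@Some_inj _)).
apply/subset_leq_card/subsetP => o /imsetP[A AM ->].
have [x -> xA] := gP A AM; apply: imset_f.
by move: xA; rewrite inE => /andP[].
Qed.

Lemma double_matching_le e M : irreflexive e -> is_matching e M -> #|M|.*2 <= n.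
Proof.
move=> ie mM; have /andP[_ /eqP tM] := mM.
rewrite -[leqRHS]card_ord; apply: leq_trans (max_card (cover M)).
rewrite -tM -muln2 -sum_nat_const; apply: leq_sum => A /(matchingP mM)[x [y [xy ->]]].
rewrite cards2; case: eqP => // xy'; by rewrite xy' ie in xy.
Qed.

(* Inducting over all vertex subsets A lets the last pendant edge xy be matched
   greedily, with x put in the cover and both x and y removed from A. *)
Lemma grown_konig V E A : grown V E -> exists M K,
  [/\ is_matching (adj E) M, cover M \subset A, #|K| <= #|M| &
     forall x y, adj E x y -> x \in A -> y \in A -> (x \in K) || (y \in K)].
Proof.
move=> gE; elim: gE A => [x|{}V {}E x y gE IH xV yV] A.
  exists set0, set0; split=> //; last by rewrite cards0.
    rewrite /is_matching; apply/andP; split; first by apply/forall_inP => B; rewrite inE.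
    by apply/trivIsetP => B B'; rewrite inE.
  by rewrite /cover big_set0 sub0set.
have sE : subrel (adj E) (adj ((x, y) :: E)).
  by move=> u w uw; rewrite adj_cons uw !orbT.
have [/andP[xA yA]|nA] := boolP ((x \in A) && (y \in A)); last first.
  have [M [K [mM cM KM eK]]] := IH A.
  exists M, K; split=> //; first exact: matching_sub mM.
  move=> u w; rewrite adj_cons => /or3P[|| /eK//] /andP[/eqP-> /eqP->] h1 h2;
    by rewrite h1 h2 in nA.
have [M [K [mM cM KM eK]]] := IH (A :\ x :\ y).
have [||||mM' cM'] := @matchingU1 (adj ((x, y) :: E)) M x y.
- exact: matching_sub mM.
- by rewrite adj_cons !eqxx.
- by apply/negP => /(subsetP cM); rewrite !inE eqxx andbF.
- by apply/negP => /(subsetP cM); rewrite !inE eqxx.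
exists ([set x; y] |: M), (x |: K); split=> //.
- rewrite /cover bigcup_setU big_set1 subUset subUset !sub1set xA yA /=.
  apply: subset_trans cM _; apply/subsetP => z; rewrite !inE.
  by case/and3P.
- by rewrite cardsU1 cM' -add1n leq_add // leq_b1.
- move=> u w; rewrite adj_cons => /or3P[/andP[/eqP-> _]|/andP[_ /eqP->]|uw] uA wA.
  + by rewrite !inE eqxx.
  + by rewrite !inE eqxx orbT.
  + rewrite !inE; have [//|ux] := eqVneq u x; have [//|wx] := eqVneq w x.
      by rewrite orbT.
    have uy : u != y by apply: contraNneq yV => <-; apply: adj_grownl gE uw.
    have wy : w != y by apply: contraNneq yV => <-; apply: adj_grownr gE uw.
    by apply: eK uw _ _; rewrite !inE ?ux ?uy ?wx ?wy.
Qed.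

(** * Degree sums of edge lists *)

Lemma sum_indicator A x : \sum_(v in A) (x == v) = (x \in A).
Proof.
have [xA|xA] := boolP (x \in A).
  rewrite (bigD1 x) //= eqxx big1 // => v /andP[_ /negbTE].
  by rewrite eq_sym => ->.
rewrite big1 // => v vA; case: eqP => // xv.
by rewrite xv vA in xA.
Qed.

Lemma sum_edge_deg_cons A x y E :
  \sum_(v in A) edge_deg ((x, y) :: E) v =
  (x \in A) + (y \in A) + \sum_(v in A) edge_deg E v.
Proof.
under eq_bigr do rewrite edge_deg_cons.
by rewrite !big_split /= !sum_indicator.
Qed.

(** Each edge contributes at least 1 through an endpoint in [K]. *)
Lemma sum_edge_deg_cover K E :
  (forall p, p \in E -> (p.1 \in K) || (p.2 \in K)) ->
  size E <= \sum_(v in K) edge_deg E v.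
Proof.
elim: E => // -[x y] E IH eK; rewrite sum_edge_deg_cons /=.
have := eK (x, y); rewrite inE eqxx /= => /(_ isT).
have {}IH : size E <= \sum_(v in K) edge_deg E v.
  by apply: IH => p pE; apply: eK; rewrite inE pE orbT.
move=> xyK; rewrite -add1n leq_add //.
by move: xyK; do 2 case: (_ \in K).
Qed.

Lemma size_grown V E : grown V E -> #|V| = (size E).+1.
Proof.
by elim=> [x|{}V {}E x y _ IH _ yV]; rewrite ?cards1 // cardsU1 yV IH.
Qed.

Lemma sum_edge_deg E : \sum_v edge_deg E v = (size E).*2.
Proof.
have -> : \sum_v edge_deg E v = \sum_(v in [set: 'I_n]) edge_deg E v.
  by apply: eq_bigl => v; rewrite inE.
elim: E => [|[x y] E IH]; first by rewrite big1.
by rewrite sum_edge_deg_cons !inE IH.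
Qed.

(** * Realizing degrees with a cover matched into its complement *)

(** The cover [C] and a matching of the same size certify each other as optimal, which fixes the
    matching number at [#|C|]. *)
Definition realizable C B f := exists E M,
  [/\ grown (C :|: B) E, {in C :|: B, edge_deg E =1 f},
     forall x y, adj E x y -> (x \in C) || (y \in C),
     is_matching (adj E) M & #|M| = #|C|].

Lemma cover_grown V E M : grown V E -> is_matching (adj E) M -> cover M \subset V.
Proof.
move=> gE mM; apply/bigcupsP => A /(matchingP mM)[x [y [xy ->]]].
by rewrite subUset !sub1set (adj_grownl gE xy) (adj_grownr gE xy).
Qed.

(** The new edge has its end [x] in [C], so cover and matching survive unchanged. *)
Lemma realizable_leaf C B f x y : [disjoint C & B] -> x \in C -> y \in B ->
  f y = 1 -> 0 < f x ->
  realizable C (B :\ y) (fun v => f v - (x == v)) -> realizable C B f.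
Proof.
move=> dCB xC yB fy fx [E [M [gE dE eC mM cM]]].
have yC : y \notin C by rewrite (disjointFl dCB).
have yV : y \notin C :|: B :\ y by rewrite !inE (negbTE yC) eqxx.
have VE : C :|: B = y |: (C :|: B :\ y).
  apply/setP => z; rewrite !inE; have [->|_] //= := eqVneq z y.
  by rewrite yB orbT.
exists ((x, y) :: E), M; split=> //.
- by rewrite VE; apply: grownS => //; rewrite inE xC.
- move=> v; rewrite VE in_setU1 edge_deg_cons => /orP[/eqP->|vV].
    rewrite (edge_deg_notin gE) // eqxx fy.
    by have -> : (x == y) = false by apply: contraNF yC => /eqP <-.
  rewrite dE //; have -> : (y == v) = false by apply: contraNF yV => /eqP {1}->.
  by have [<-|_] := eqVneq x v; rewrite ?addn0 ?add0n ?subn0 // subnKC.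
- move=> u w; rewrite adj_cons => /or3P[/andP[/eqP-> _]|/andP[_ /eqP->]|/eC//].
    by rewrite xC.
  by rewrite xC orbT.
- by apply: matching_sub mM => u w uw; rewrite adj_cons uw !orbT.
Qed.

(** The vertex [c] covers both new edges, and the edge [cb] enlarges the matching by one just as [C]
    grows by one. Therefore [x] may lie on either side. *)
Lemma realizable_path C B f x c b : [disjoint C & B] -> c \in C -> b \in B ->
  x \in (C :\ c) :|: (B :\ b) -> f c = 2 -> f b = 1 -> 0 < f x ->
  realizable (C :\ c) (B :\ b) (fun v => f v - (x == v)) -> realizable C B f.
Proof.
move=> dCB cC bB xV fc fb fx [E [M [gE dE eC mM cM]]].
have bC : b \notin C by rewrite (disjointFl dCB).
have cB : c \notin B by rewrite (disjointFr dCB).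
have bc : b != c by apply: contraNneq bC => ->.
have cV : c \notin C :\ c :|: B :\ b by rewrite !inE eqxx (negbTE cB) andbF.
have bV : b \notin c |: (C :\ c :|: B :\ b).
  by rewrite !inE eqxx (negbTE bC) (negbTE bc) andbF.
have VE : C :|: B = b |: (c |: (C :\ c :|: B :\ b)).
  apply/setP => z; rewrite !inE; have [->|_] //= := eqVneq z b.
    by rewrite bB orbT.
  by have [->|] //= := eqVneq z c; rewrite cC.
have gE1 : grown (c |: (C :\ c :|: B :\ b)) ((x, c) :: E) by apply: grownS.
have gE2 : grown (C :|: B) ((c, b) :: (x, c) :: E).
  by rewrite VE; apply: grownS => //; rewrite inE set11.
have sE : subrel (adj E) (adj ((c, b) :: (x, c) :: E)).
  by move=> u w uw; rewrite !adj_cons uw !orbT.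
have xc : x != c by apply: contraNneq cV => {1}<-.
have xb : x != b by apply: contraNneq bV => {1}<-; rewrite inE xV orbT.
have covV := subsetP (cover_grown gE mM).
have [||||mM' cM'] := @matchingU1 (adj ((c, b) :: (x, c) :: E)) M c b.
- exact: matching_sub mM.
- by rewrite adj_cons !eqxx.
- by apply: contra cV; apply: covV.
- by apply: contra bV => /covV h; rewrite inE h orbT.
exists ((c, b) :: (x, c) :: E), ([set c; b] |: M); split=> //.
- move=> v; rewrite VE in_setU1 !edge_deg_cons => /orP[/eqP->|].
    rewrite (edge_deg_notin gE); last by apply: contra bV => h; rewrite inE h orbT.
    by rewrite (eq_sym c) (negbTE bc) (negbTE xb) eqxx fb.
  rewrite in_setU1 => /orP[/eqP->|vV].
    by rewrite (edge_deg_notin gE) // eqxx (negbTE bc) (negbTE xc) fc.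
  rewrite dE //; have -> : (c == v) = false by apply: contraNF cV => /eqP {1}->.
  have -> : (b == v) = false.
    by apply: contraNF bV => /eqP {1}->; rewrite inE vV orbT.
  by have [<-|_] := eqVneq x v; rewrite ?addn0 ?add0n ?subn0 // subnKC.
- move=> u w; rewrite !adj_cons.
  case/or3P => [/andP[/eqP-> _]|/andP[_ /eqP->]|]; rewrite ?cC ?orbT //.
  case/or3P => [/andP[_ /eqP->]|/andP[/eqP-> _]|]; rewrite ?cC ?orbT //.
  by move=> /eC; rewrite !inE => /orP[]/andP[_ ->]; rewrite ?orbT.
- by rewrite cM' cM [in RHS](cardsD1 c) cC.
Qed.

Lemma leq_mul_card A f k : {in A, forall v, k <= f v} -> k * #|A| <= \sum_(v in A) f v.
Proof. by move=> fk; rewrite mulnC -sum_nat_const; apply: leq_sum. Qed.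

Lemma sum_subn_indicator A f x : 0 < f x ->
  \sum_(v in A) (f v - (x == v)) + (x \in A) = \sum_(v in A) f v.
Proof.
move=> fx; rewrite -(sum_indicator A x) -big_split /=; apply: eq_bigr => v _.
by have [<-|_] := eqVneq x v; rewrite ?subn0 ?addn0 // subnK.
Qed.

(* C becomes a vertex cover matched into B.  Some b in B has degree 1, and the
   induction undoes either a pendant edge xb with x in C, or a pendant path
   x - c - b with c in C of degree 2.  The exception for #|B| = 1 lets the
   induction end in K_2. *)
Lemma exists_realization C B f : [disjoint C & B] -> 0 < #|C| <= #|B| ->
  {in C :|: B, forall v, 0 < f v} -> {in C, forall v, 2 <= f v} \/ #|B| = 1 ->
  \sum_(v in C) f v + \sum_(v in B) f v + 2 = (#|C| + #|B|).*2 ->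
  \sum_(v in B) f v < #|C| + #|B| -> realizable C B f.
Proof.
have [N] := ubnP (#|C| + #|B|); elim: N C B f => // N IH C B f leN dCB kB f_gt0 C2 sCB sB.
have f_gt0B : {in B, forall v, 0 < f v} by move=> v vB; apply: f_gt0; rewrite inE vB orbT.
have sBge := leq_mul_card f_gt0B.
(* Otherwise the degrees in [B] sum to at least [2 * #|B|], hence at least [#|C| + #|B|], against
   the strict bound. *)
have [b bB fb] : exists2 b, b \in B & f b = 1.
  have [/exists_inP[b bB /eqP fb]|nb] := boolP [exists b in B, f b == 1]; first by exists b.
  have: 2 * #|B| <= \sum_(v in B) f v.
    apply: leq_mul_card => v vB; have := f_gt0B v vB.
    by move: nb; rewrite negb_exists_in => /forall_inP/(_ v vB); card_lia.
  by card_lia.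
have bC : b \notin C by rewrite (disjointFl dCB).
have cBb : #|B| = #|B :\ b|.+1 by rewrite (cardsD1 b) bB.
have sBb g : \sum_(v in B) g v = g b + \sum_(v in B :\ b) g v by rewrite (big_setD1 b).
have sub_pos C' B' x : C' \subset C -> B' \subset B ->
    ({in C' :|: B', forall v, 0 < f v - (x == v)} <-> (x \in C' :|: B' -> 1 < f x)).
  move=> sC sB'; split=> [h /h|h v vV]; first by rewrite eqxx; card_lia.
  have: 0 < f v.
    by apply: f_gt0; move: vV; rewrite !inE => /orP[/(subsetP sC)->|/(subsetP sB')->]; rewrite ?orbT.
  by have [xv|_] := eqVneq x v; [move: h; rewrite xv vV => /(_ isT)|]; card_lia.
(* Removing [b] lowers the degree of [x]: it stays at least 2 if it was at least 3, and otherwise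
   [#|B| = 2] puts the smaller instance in the exceptional case. *)
have leaf_step x : x \in C -> 2 <= f x -> 2 <= #|B| -> #|C| < #|B| -> 3 <= f x \/ #|B| = 2 ->
    {in C, forall v, 2 <= f v} -> realizable C B f.
  move=> xC fx B2 CB fx3 {}C2; have fx0 : 0 < f x by card_lia.
  apply: (realizable_leaf dCB xC bB fb fx0); apply: IH.
  - by card_lia.
  - by apply: disjointWr dCB; apply: subD1set.
  - by card_lia.
  - by apply/sub_pos => //; apply: subD1set.
  - case: fx3 => [fx3|]; last by right; card_lia.
    by left=> v vC; have := C2 v vC; have [<-|_] := eqVneq x v; card_lia.
  - have := sum_subn_indicator C fx0; have := sum_subn_indicator (B :\ b) fx0.
    have := sBb f; rewrite xC inE (disjointFr dCB xC) andbF fb; card_lia.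
  - have := sum_subn_indicator (B :\ b) fx0.
    have := sBb f; rewrite fb; card_lia.
have [B1|B1] := eqVneq #|B| 1.
  have /cards1P[c Cc] : #|C| == 1 by apply/eqP; card_lia.
  have /cards1P[b' Bb] : #|B| == 1 by apply/eqP.
  move: bB; rewrite Bb inE => /eqP bb; subst b'.
  have cb : c != b by move: bC; rewrite Cc inE eq_sym.
  have fc : f c = 1.
    by move: sCB; rewrite Cc Bb !big_set1 !cards1 fb; card_lia.
  have gE : grown (b |: [set c]) [:: (c, b)].
    by apply: grownS; [apply: grown1|rewrite inE|rewrite inE eq_sym].
  have m0 : is_matching (adj [:: (c, b)]) set0.
    apply/andP; split; first by apply/forall_inP => A; rewrite inE.
    by apply/trivIsetP => A A'; rewrite inE.
  have [|||mM cM] := matchingU1 (x := c) (y := b) m0.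
  - by rewrite adj_cons !eqxx.
  - by rewrite /cover big_set0 inE.
  - by rewrite /cover big_set0 inE.
  exists [:: (c, b)], ([set c; b] |: set0); split=> //.
  + by rewrite Cc setUC.
  + move=> v; rewrite Cc !inE edge_deg_cons => /orP[]/eqP->.
      by rewrite eqxx eq_sym (negbTE cb) fc.
    by rewrite eqxx (negbTE cb) fb.
  + move=> u w; rewrite adj_cons Cc !inE orbF.
    by case/orP => /andP[/eqP-> /eqP->]; rewrite eqxx ?orbT.
  + by rewrite cM cards0 Cc cards1.
have {}C2 : {in C, forall v, 2 <= f v} by case: C2 => // B1'; rewrite B1' in B1.
have B2 : 2 <= #|B| by card_lia.
have sCge := leq_mul_card C2.
(* A star: the degree sum forces the centre to have degree [#|B|]. *)
have [C1|C1] := eqVneq #|C| 1.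
  have /cards1P[c Cc] : #|C| == 1 by apply/eqP.
  have cC : c \in C by rewrite Cc inE.
  have fc : f c = #|B|.
    have : \sum_(v in C) f v = f c by rewrite Cc big_set1.
    by card_lia.
  by apply: (leaf_step c) => //; card_lia.
have [/andP[CB /exists_inP[x xC fx]]|nleaf] :=
    boolP ((#|C| < #|B|) && [exists x in C, 3 <= f x]).
  by apply: (leaf_step x) => //; [apply: ltnW|left].
have allC2 : #|C| < #|B| -> {in C, forall v, f v = 2}.
  move=> CB v vC; move: nleaf; rewrite CB negb_exists_in => /forall_inP/(_ v vC).
  by have := C2 v vC; card_lia.
(* If [#|C| = #|B|] and all degrees in [C] were at least 3, the total degree would be at least
   [4 * #|C|], exceeding the prescribed [4 * #|C| - 2]. *)
have [c cC fc] : exists2 c, c \in C & f c = 2.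
  have [/exists_inP[c cC /eqP fc]|nc] := boolP [exists c in C, f c == 2]; first by exists c.
  have [CB|CB] := ltnP #|C| #|B|.
    have /card_gt0P[c cC] : 0 < #|C| by card_lia.
    by exists c => //; apply: allC2.
  have: 3 * #|C| <= \sum_(v in C) f v.
    apply: leq_mul_card => v vC; have := C2 v vC.
    by move: nc; rewrite negb_exists_in => /forall_inP/(_ v vC); card_lia.
  by card_lia.
have cB : c \notin B by rewrite (disjointFr dCB).
have cCc : #|C| = #|C :\ c|.+1 by rewrite (cardsD1 c) cC.
have sCc g : \sum_(v in C) g v = g c + \sum_(v in C :\ c) g v by rewrite (big_setD1 c).
(* Removing [b] lowers the sum over [B] by 1, while the bound drops by 2. The second unit comes from
   [x] if it lies in [B]; for [x] in [C] one unit of slack is required, hence the term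
   [(x \in C)]. *)
have path_step x : x \in C :\ c :|: B :\ b -> 2 <= f x ->
    (x \in C -> 3 <= f x \/ #|B| = 2) ->
    \sum_(v in B) f v + (x \in C) < #|C| + #|B| -> realizable C B f.
  move=> xV fx xC3 sB'; have fx0 : 0 < f x by card_lia.
  apply: (realizable_path dCB cC bB xV fc fb fx0); apply: IH.
  - by card_lia.
  - by apply: disjointWl (subD1set _ _) (disjointWr (subD1set _ _) dCB).
  - by card_lia.
  - by apply/sub_pos => //; apply: subD1set.
  - have [xC|xC] := boolP (x \in C); last first.
      left=> v; rewrite inE => /andP[_ vC]; have := C2 v vC.
      by have [xv|_] := eqVneq x v; [rewrite xv vC in xC|card_lia].
    case: (xC3 xC) => [fx3|]; last by right; card_lia.
    left=> v; rewrite inE => /andP[_ vC].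
    by have := C2 v vC; have [<-|_] := eqVneq x v; card_lia.
  - have := sum_subn_indicator (C :\ c) fx0; have := sum_subn_indicator (B :\ b) fx0.
    have := sBb f; have := sCc f; rewrite fb fc.
    have : (x \in C :\ c) + (x \in B :\ b) = 1.
      move: xV; rewrite in_setU; have [xC _|_ /=->//] := boolP (x \in C :\ c).
      have [_ xC'] := setD1P xC.
      by rewrite !inE (disjointFr dCB xC') andbF.
    by card_lia.
  - have := sum_subn_indicator (B :\ b) fx0; have := sBb f; rewrite fb.
    have : (x \in C) + (x \in B :\ b) = 1.
      move: xV; rewrite !inE; have [xC|xC] := boolP (x \in C).
        by rewrite (disjointFr dCB xC) andbF.
      by rewrite andbF /= => ->.
    by card_lia.
have [/exists_inP[x xB fx]|nx] := boolP [exists x in B, 2 <= f x].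
  have xC : x \in C = false by rewrite (disjointFl dCB).
  apply: (path_step x) => //; rewrite ?xC ?addn0 // !inE xB.
  by rewrite andbT; apply/orP; right; apply: contraTneq fx => ->; rewrite fb.
have sBE : \sum_(v in B) f v = #|B|.
  rewrite -sum1_card; apply: eq_bigr => v vB; have := f_gt0B v vB.
  by move: nx; rewrite negb_exists_in => /forall_inP/(_ v vB); card_lia.
(* With all of [C] of degree 2 and all of [B] of degree 1, the degree sum gives [#|B| = 2], so
   [#|C| = 1], which is excluded. *)
have [CB|CB] := ltnP #|C| #|B|.
  have: \sum_(v in C) f v = #|C| * 2 by rewrite -sum_nat_const; apply: eq_bigr; apply: allC2.
  by card_lia.
(* Now [#|C| = #|B|] and the degrees in [C] sum to [3 * #|C| - 2]. If all were 2, then [#|C| = 2],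
   so a larger one exists unless [#|B| = 2]. *)
have [x xC fx] : exists2 x, x \in C :\ c & 3 <= f x \/ #|B| = 2.
  have [B2'|B3] := eqVneq #|B| 2.
    have /card_gt0P[x xC] : 0 < #|C :\ c| by card_lia.
    by exists x => //; right.
  have [/exists_inP[x xC fx]|nx'] := boolP [exists x in C :\ c, 3 <= f x].
    by exists x => //; left.
  have: \sum_(v in C :\ c) f v = #|C :\ c| * 2.
    rewrite -sum_nat_const; apply: eq_bigr => v vC; have [_ /C2 fv] := setD1P vC.
    by move: nx'; rewrite negb_exists_in => /forall_inP/(_ v vC); card_lia.
  by have := sCc f; card_lia.
have [_ xC'] := setD1P xC.
apply: (path_step x) => //.
- by rewrite inE xC.
- exact: C2.
- by rewrite xC' sBE addnC ltn_add2r; card_lia.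
Qed.

(** * Degrees in trees *)

Lemma tree_deg_gt0 e v : 1 < n -> is_tree e -> 0 < deg e v.
Proof.
move=> n1 [_ [ce _]].
have /card_gt0P[w] : 0 < #|~: [set v]|.
  by have := cardsC [set v]; rewrite cards1 card_ord => vn; card_lia.
rewrite inE => wv; have [a [b [+ _ ab]]] := connected_crossing ce (set11 v) wv.
by rewrite inE => /eqP <-; apply/card_gt0P; exists b; rewrite inE.
Qed.

(** A third vertex forces an edge out of [{x, y}], and its end in that pair then has two
    neighbours. *)
Lemma tree_edge_nonleaf e x y : 2 < n -> is_tree e -> e x y ->
  (1 < deg e x) || (1 < deg e y).
Proof.
move=> n2 [[se _] [ce _]] xy.
have /card_gt0P[w] : 0 < #|~: [set x; y]|.
  by have := cardsC [set x; y]; rewrite cards2 card_ord; case: (x != y) => xyn; card_lia.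
rewrite inE => wv; have [a [b [+ bV ab]]] := connected_crossing ce (set21 x y) wv.
have deg2 u v : e u v -> e u b -> v != b -> 1 < deg e u.
  move=> uv ub vb; have : #|[set v; b]| = 2 by rewrite cards2 vb.
  by move=> <-; apply: subset_leq_card; rewrite subUset !sub1set !inE uv ub.
move: bV; rewrite !inE negb_or => /andP[bx by_] /orP[]/eqP aE; subst a.
  by rewrite (deg2 x y) // eq_sym.
by rewrite (deg2 y x) ?orbT // 1?eq_sym // se.
Qed.

End EdgeLists.

Lemma tree_sum_deg n (e : rel 'I_n) : 0 < n -> is_tree e ->
  \sum_v deg e v = n.-1.*2.
Proof.
move=> n0 te; have [E gE eE] := tree_grown n0 te.
have -> : n.-1 = size E by have := size_grown gE; rewrite cardsT card_ord; lia.
rewrite -sum_edge_deg; apply: eq_bigr => v _; rewrite -(deg_grown v gE).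
by congr #|pred_of_set _|; apply/setP => w; rewrite !inE eE.
Qed.

(** * Sorted degree sequences and prefix sums *)

Lemma geq_total : total geq.
Proof. by move=> a b; apply: leq_total. Qed.

Lemma geq_trans : transitive geq.
Proof. by move=> a b c /= ab ca; apply: leq_trans ca ab. Qed.

(** The head of a nonincreasing list bounds every entry of a subsequence, so heads are compared
    first and the tails by induction. *)
Lemma sumn_subseq_take (t s : seq nat) :
  sorted geq s -> subseq t s -> sumn t <= sumn (take (size t) s).
Proof.
elim: s t => [|a s IH] [|b t] // ss st.
have ba : b <= a.
  have := mem_subseq st (mem_head b t); rewrite inE => /orP[/eqP->//|].
  by have /allP := order_path_min geq_trans ss; apply.
rewrite [take _ _]/= leq_add // IH ?(path_sorted ss) //.
by move: st; rewrite /=; case: eqP => // _; apply: cons_subseq.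
Qed.

Lemma prefix_sumE (d : seq nat) k : k <= size d ->
  \sum_(i < k) nth 0 d i = sumn (take k d).
Proof.
move=> kd; rewrite sumnE (big_nth 0) size_takel // big_mkord.
by apply: eq_bigr => i _; rewrite nth_take.
Qed.

Lemma leq_prefix_sum (d : seq nat) j k : j <= k ->
  \sum_(i < j) nth 0 d i <= \sum_(i < k) nth 0 d i.
Proof.
move=> jk; rewrite -!(big_mkord xpredT (nth 0 d)).
by rewrite [leqRHS](big_cat_nat (leq0n j) jk) /= leq_addr.
Qed.

Lemma min_prefix_leE (d : seq nat) m k : k <= size d ->
  (min_prefix d m <= k) = (m <= \sum_(i < k) nth 0 d i).
Proof.
move=> kd; set P := fun k => m <= \sum_(i < k) nth 0 d i.
apply/idP/idP => [le|Pk].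
  (* As [k <= size d], the value is not the default of a failed search. *)
  have lt_find : min_prefix d m < (size d).+1 by apply: leq_ltn_trans le _.
  have hP : has P (iota 0 (size d).+1) by rewrite has_find size_iota.
  have := nth_find 0 hP; rewrite nth_iota //.
  move=> /leq_trans; apply; exact: leq_prefix_sum.
rewrite leqNgt; apply/negP => /(before_find 0).
by rewrite nth_iota // add0n => /negP; apply.
Qed.

Lemma size_degree_seq n (e : rel 'I_n) : size (degree_seq e) = n.
Proof. by rewrite size_sort size_map size_enum_ord. Qed.

(** Sorting the vertices themselves turns a prefix of the degree sequence into a set of vertices of
    largest degree. *)
Lemma degree_seqE n (e : rel 'I_n) :
  degree_seq e = map (deg e) (sort (relpre (deg e) geq) (enum 'I_n)).
Proof. exact: sort_map. Qed.

Lemma sum_deg_le_prefix n (e : rel 'I_n) (K : {set 'I_n}) :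
  \sum_(v in K) deg e v <= \sum_(i < #|K|) nth 0 (degree_seq e) i.
Proof.
rewrite prefix_sumE; last by rewrite size_degree_seq -[leqRHS]card_ord max_card.
have -> : \sum_(v in K) deg e v = sumn (sort geq (map (deg e) (enum K))).
  rewrite (perm_sumn (permEl (perm_sort _ _))) sumnE big_map.
  by rewrite big_enum.
have sK : size (sort geq (map (deg e) (enum K))) = #|K|.
  by rewrite size_sort size_map cardE.
rewrite -[in leqRHS]sK; apply: sumn_subseq_take.
  exact: sort_sorted geq_total _.
apply: (subseq_sort geq_total geq_trans); apply: map_subseq.
by rewrite enumT; apply: filter_subseq.
Qed.

Lemma n1_degree_seq n (e : rel 'I_n) :
  n1 (degree_seq e) = #|[set v | deg e v == 1]|.
Proof.
rewrite /n1 (permP (permEl (perm_sort _ _))) count_map -size_filter cardE.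
by congr size; rewrite {2}/enum_mem -enumT; apply: eq_filter => v; rewrite !inE.
Qed.

Lemma tree_nonleaf_card n (e : rel 'I_n) : 1 < n -> is_tree e ->
  #|[set v | 1 < deg e v]| = n - n1 (degree_seq e).
Proof.
move=> n1 te; rewrite cardsCs card_ord n1_degree_seq.
congr (_ - #|pred_of_set _|); apply/setP => v; rewrite !inE.
by have := tree_deg_gt0 v n1 te; case: (deg e v) => [|[]].
Qed.

(** * Matching numbers of trees: necessity and sufficiency *)

Lemma matching_number_eq n (e : rel 'I_n) (M : {set {set 'I_n}}) (K : {set 'I_n}) :
  is_matching e M -> (forall x y, e x y -> (x \in K) || (y \in K)) ->
  #|K| <= #|M| -> matching_number e = #|M|.
Proof.
move=> mM eK KM; apply/eqP; rewrite eqn_leq; apply/andP; split; last first.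
  exact: (@leq_bigmax_cond _ _ (fun M : {set {set 'I_n}} => #|M|)).
by apply/bigmax_leqP => M' mM'; apply: leq_trans KM; apply: matching_le_cover mM' eK.
Qed.

Lemma tree_matching_number_bounds n (e : rel 'I_n) : 2 < n -> is_tree e ->
  min_prefix (degree_seq e) n.-1 <= matching_number e
    <= minn n./2 (n - n1 (degree_seq e)).
Proof.
move=> n2 te; have n0 : 0 < n by lia.
have [E gE eE] := tree_grown n0 te.
have mE M : is_matching (adj E) M -> is_matching e M.
  by apply: matching_sub => x y; rewrite eE.
(* Taking the whole vertex set for [A] makes [K] a cover of all edges. *)
have [M [K [mM _ KM eK]]] := grown_konig setT gE.
have {}eK x y : adj E x y -> (x \in K) || (y \in K) by move=> /eK; rewrite !inE; apply.
have nuE : matching_number e = #|M|.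
  by apply: (@matching_number_eq _ e M K) => // [|x y]; [apply: mE|rewrite eE; apply: eK].
have ie : irreflexive e by case: te => -[].
have M2 := double_matching_le ie (mE _ mM).
rewrite nuE leq_min; apply/and3P; split.
- rewrite min_prefix_leE; last by rewrite size_degree_seq; lia.
  have KMs : \sum_(i < #|K|) nth 0 (degree_seq e) i <= \sum_(i < #|M|) nth 0 (degree_seq e) i.
    exact: leq_prefix_sum.
  apply: leq_trans KMs; apply: leq_trans (sum_deg_le_prefix e K).
  have -> : n.-1 = size E by have := size_grown gE; rewrite cardsT card_ord; lia.
  have -> : \sum_(v in K) deg e v = \sum_(v in K) edge_deg E v.
    apply: eq_bigr => v _; rewrite -(deg_grown v gE).
    by congr #|pred_of_set _|; apply/setP => w; rewrite !inE eE.
  by apply: sum_edge_deg_cover => -[x y] xyE; apply: eK; rewrite /adj xyE.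
- by rewrite -leq_double; lia.
- rewrite -(tree_nonleaf_card _ te); last by lia.
  apply: matching_le_cover (mE _ mM) _ => x y xy; rewrite !inE.
  exact: tree_edge_nonleaf.
Qed.

Lemma tree_matching_number_realize n (e : rel 'I_n) nu : 2 < n -> is_tree e ->
  min_prefix (degree_seq e) n.-1 <= nu <= minn n./2 (n - n1 (degree_seq e)) ->
  exists e' : rel 'I_n,
    is_tree e' /\ degree_seq e' = degree_seq e /\ matching_number e' = nu.
Proof.
move=> n2 te; rewrite leq_min => /and3P[lo hi1 hi2].
have nun : nu <= n by lia.
rewrite min_prefix_leE ?size_degree_seq // in lo.
set s := sort (relpre (deg e) geq) (enum 'I_n).
have us : uniq s by rewrite sort_uniq enum_uniq.
have ss : size s = n by rewrite size_sort size_enum_ord.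
pose C := [set v in take nu s]; pose B := [set v in drop nu s].
have CBT : C :|: B = setT.
  by apply/setP => v; rewrite !inE -mem_cat cat_take_drop mem_sort mem_enum.
have dCB : [disjoint C & B].
  have := us; rewrite -{1}(cat_take_drop nu s) cat_uniq => /and3P[_ /hasPn h _].
  rewrite disjoint_sym disjoint_subset; apply/subsetP => v; rewrite !inE.
  exact: h.
have cC : #|C| = nu.
  by rewrite cardsE (card_uniqP (take_uniq nu us)) size_takel // ss.
have cB : #|B| = n - nu.
  by rewrite cardsE (card_uniqP (drop_uniq nu us)) size_drop ss.
have sC : \sum_(v in C) deg e v = \sum_(i < nu) nth 0 (degree_seq e) i.
  rewrite prefix_sumE ?size_degree_seq // degree_seqE -/s -map_take sumnE big_map.
  rewrite big_uniq ?take_uniq //=; by apply: eq_bigl => v; rewrite inE.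
have sT : \sum_(v in C) deg e v + \sum_(v in B) deg e v = n.-1.*2.
  rewrite -(tree_sum_deg _ te) -?bigU //=; last by lia.
  apply: eq_bigl => v; have : v \in C :|: B by rewrite CBT inE.
  by rewrite in_setU.
have CB_le u w : u \in C -> w \in B -> deg e w <= deg e u.
  rewrite !inE => uC wB.
  have: sorted (relpre (deg e) geq) s by apply: sort_sorted => a b; apply: leq_total.
  rewrite sorted_pairwise; last by move=> a b c; apply: geq_trans.
  rewrite -(cat_take_drop nu s) pairwise_cat => /and3P[/allrelP h _ _].
  exact: h.
(* A vertex [v] of [C] with degree at most 1 would bound all degrees in [B] by 1. The non-leaves
   would then lie in [C :\ v], too few for [nu <= n - n1]. *)
have C2 : {in C, forall v, 1 < deg e v}.
  move=> v vC; rewrite ltnNge; apply/negP => dv.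
  have: [set v | 1 < deg e v] \subset C :\ v.
    apply/subsetP => w; rewrite !inE => dw; apply/andP; split.
      by apply: contraTneq dw => ->; rewrite -leqNgt.
    have : w \in C :|: B by rewrite CBT inE.
    rewrite in_setU => /orP[|/(CB_le _ _ vC)]; first by rewrite inE.
    by lia.
  move/subset_leq_card; rewrite tree_nonleaf_card //; last by lia.
  by have := cardsD1 v C; rewrite vC cC => cCv; card_lia.
have nu0 : 0 < nu.
  by case: (posnP nu) lo => // ->; rewrite big_ord0; lia.
have [E [M [gE dE eC mM cM]]] : realizable C B (deg e).
  (* The bound [nu <= n./2] gives [#|C| <= #|B|]. The lower bound on [nu] gives [C] a degree sum of
     at least [n.-1], leaving at most [n.-1] of the total [n.-1.*2] to [B]. *)
  apply: exists_realization => //.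
  - by rewrite cC cB; lia.
  - by move=> v _; apply: tree_deg_gt0 => //; lia.
  - by left.
  - by rewrite sT cC cB; lia.
  - by move: lo; rewrite cC cB -sC; card_lia.
rewrite CBT in gE dE.
exists (adj E); split; first exact: grown_is_tree.
split; last by rewrite (matching_number_eq mM eC) ?cM.
congr (sort geq _); apply: eq_map => v.
by rewrite (deg_grown v gE) dE ?inE.
Qed.

Theorem theorem1 (n : nat) (d : seq nat) (nu : nat) :
  3 <= n -> is_tree_degree_sequence n d ->
  (exists e : rel 'I_n, is_tree e /\ degree_seq e = d /\ matching_number e = nu) <->
  (min_prefix d n.-1 <= nu <= minn n./2 (n - n1 d)).
Proof.
move=> n3 [e0 [te0 <-]]; split=> [[e [te [<- <-]]]|].
  exact: tree_matching_number_bounds.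
exact: tree_matching_number_realize.
Qed.
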